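(* Let $C$ be a bounded, closed set in $\mathbb{R}^{m\times n}$. Suppose that $C$ contains a minimum rank element $X^*$ with the least F-norm, i.e., $X^*\in C$ satisfies $\operatorname{rank}(X^* )\le\operatorname{rank}(X)$ and $\|X^*\|_F\le\|X\|_F$ for all $X\in C$; put $r^*=\operatorname{rank}(X^* )$. For $\varepsilon,\gamma>0$ let $(Y_{\varepsilon,\gamma},Z_{\varepsilon,\gamma},X_{\varepsilon,\gamma})$ denote the optimal solution of the problem $$\begin{array}{cl}\text{minimize} & \operatorname{tr}(Y)+\frac1\gamma\operatorname{tr}(Z)\\ \text{s.t.} & \begin{pmatrix} Y & X \\ X^T & Z+\varepsilon I \end{pmatrix}\succeq0,\quad \begin{pmatrix} I & X \\ X^T & Z \end{pmatrix}\succeq0,\quad X\in C,\end{array}$$ over $Y\in S^m$, $Z\in S^n$, $X\in\mathbb{R}^{m\times n}$. Then $\operatorname{tr}(Y_{\varepsilon,\gamma})\le\phi_\varepsilon(X^* )\le\operatorname{rank}(X^* )$ for all $(\varepsilon,\gamma)>0$, and $$\lim_{(\varepsilon,\gamma)\to0,\ \gamma/\varepsilon\to0}\operatorname{tr}(Y_{\varepsilon,\gamma})=r^*=\operatorname{rank}(X^* ),\qquad \lim_{(\varepsilon,\gamma)\to0,\ \gamma/\varepsilon\to0}\operatorname{tr}(Z_{\varepsilon,\gamma})=\|X^*\|_F^2,$$ and the sequence $\{X_{\varepsilon,\gamma}\}$ converges to the set of minimum rank solutions (the set of minimizers of $\operatorname{rank}(X)$ over $X\in C$) as $(\varepsilon,\gamma)\to0$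 and $\gamma/\varepsilon\to0$.
   Context: $S^k$ is the set of real symmetric $k\times k$ matrices; $A\succeq0$ means $A$ is symmetric positive semidefinite; $I$ is an identity matrix of the appropriate size; $\|X\|_F$ is the Frobenius norm. For $\varepsilon>0$, $\phi_\varepsilon(X)=\operatorname{tr}\left(X(X^TX+\varepsilon I)^{-1}X^T\right)$. ''The optimal solution'' means any chosen optimal solution for each $(\varepsilon,\gamma)$. Convergence to a set means that the distance from $X_{\varepsilon,\gamma}$ to the set tends to $0$. $(\varepsilon,\gamma)>0$ means both $\varepsilon>0$ and $\gamma>0$. *)

(* Defs.v *)
From HB Require Import structures.
From mathcomp Require Export all_boot all_order all_algebra.
From mathcomp Require Export all_classical all_reals all_analysis.

Set Implicit Arguments.
Unset Strict Implicit.
Unset Printing Implicit Defensive.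

Import Order.TTheory GRing.Theory Num.Theory.
Import numFieldNormedType.Exports.

Local Open Scope classical_set_scope.
Local Open Scope ring_scope.

Section matrices.
Variables (R : realType) (m n : nat).

Definition psdmx (k : nat) (A : 'M[R]_k) : Prop :=
  A^T = A /\ forall v : 'cV[R]_k, 0 <= (v^T *m A *m v) 0 0.

Definition frob_norm (X : 'M[R]_(m, n)) : R :=
  Num.sqrt (\sum_i \sum_j X i j ^+ 2).

(* Extended-real valued, so that the distance to the empty set is +oo. *)
Definition frob_dist (X : 'M[R]_(m, n)) (S : set 'M[R]_(m, n)) : \bar R :=
  ereal_inf [set (frob_norm (X - W))%:E | W in S].

Definition phi (eps : R) (X : 'M[R]_(m, n)) : R :=
  \tr (X *m invmx (X^T *m X + eps%:M) *m X^T).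

Definition min_rank_solutions (C : set 'M[R]_(m, n)) : set 'M[R]_(m, n) :=
  [set W | C W /\ forall V, C V -> (\rank W <= \rank V)%N].

Definition feasible (C : set 'M[R]_(m, n)) (eps : R)
    (Y : 'M[R]_m) (Z : 'M[R]_n) (X : 'M[R]_(m, n)) : Prop :=
  [/\ Y^T = Y, Z^T = Z,
      psdmx (block_mx Y X X^T (Z + eps%:M)),
      psdmx (block_mx 1%:M X X^T Z) &
      C X].

Definition objective (gam : R) (Y : 'M[R]_m) (Z : 'M[R]_n) : R :=
  \tr Y + gam^-1 * \tr Z.

Definition optimal (C : set 'M[R]_(m, n)) (eps gam : R)
    (Y : 'M[R]_m) (Z : 'M[R]_n) (X : 'M[R]_(m, n)) : Prop :=
  feasible C eps Y Z X /\
  forall Y' Z' X', feasible C eps Y' Z' X' ->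
    objective gam Y Z <= objective gam Y' Z'.

End matrices.

(* The filter on pairs (eps, gam) of positive reals expressing
   (eps, gam) -> 0 and gam / eps -> 0. *)
Definition ratio_to0 (R : realType) : set_system (R * R) :=
  [set A | exists2 d : R, 0 < d &
     forall eps gam : R, 0 < eps < d -> 0 < gam < d -> gam / eps < d ->
       A (eps, gam)].
Arguments ratio_to0 R : clear implicits.

Global Instance ratio_to0_filter (R : realType) : ProperFilter (ratio_to0 R).
Proof.
apply: Build_ProperFilter_ex.
  move=> A [d d0 Ad]; exists (d / 2, Num.min (d / 2) (d / 2 * (d / 2))).
  have h0 : 0 < d / 2 by rewrite divr_gt0.
  have hd : d / 2 < d by rewrite ltr_pdivrMr// mulr_natr mulr2n ltrDl.
  apply: Ad.
  - by rewrite h0.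
  - by rewrite lt_min h0 mulr_gt0//= gt_min hd.
  - by rewrite ltr_pdivrMr// gt_min (ltr_pM2r h0) hd orbT.
constructor.
- by exists 1.
- move=> A B [d d0 Ad] [e e0 Be]; exists (Num.min d e).
    by rewrite lt_min d0 e0.
  move=> x y; rewrite !lt_min => /and3P[x0 xd xe] /and3P[y0 yd ye] /andP[rd re].
  by split; [apply: Ad | apply: Be]; rewrite ?x0 ?y0.
- move=> A B AB [d d0 Ad]; exists d => // x y hx hy hr.
  by apply: AB; apply: Ad.
Qed.

(* Main.v *)
(* For every fixed [V], testing the first block constraint with the columns of
   [(I, -V^T)] gives
     tr Y >= 2 tr(X V) - |X V|_F^2 - tr(V^T (Z - X^T X + eps I) V),
   a bound continuous in [X].  If [X V] is the orthogonal projection onto the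
   column space of [X], the first two terms equal [rank X], so by compactness a
   lower bound on the rank over a compact set yields a lower bound on [tr Y]
   that is uniform over that set as soon as [eps] and the slack
   [tr(Z - X^T X)] are small.
   Comparing the optimum with the feasible point [(_, Xstar^T Xstar, Xstar)]
   bounds this slack by [gam * rank Xstar] and gives
   [tr Y <= phi eps Xstar <= rank Xstar].  The limits follow by using the
   uniform bound on [C], and on [C] minus a neighbourhood of the set of minimum
   rank solutions. *)
Require Import Defs.
From mathcomp Require Import ring lra.
Import Order.TTheory GRing.Theory Num.Theory.
Import numFieldNormedType.Exports.

Set Implicit Arguments.
Unset Strict Implicit.
Unset Printing Implicit Defensive.

Local Open Scope classical_set_scope.
Local Open Scope ring_scope.

(** * Gram matrices, their traces and orthogonal projections *)

Section traces.
Variable R : realType.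

Lemma mxtrace_trmul p q (A : 'M[R]_(p, q)) :
  \tr (A^T *m A) = \sum_i \sum_j A i j ^+ 2.
Proof.
rewrite /mxtrace exchange_big; apply: eq_bigr => j _; rewrite mxE.
by apply: eq_bigr => i _; rewrite mxE expr2.
Qed.

Lemma mxtrace_trmul_ge0 p q (A : 'M[R]_(p, q)) : 0 <= \tr (A^T *m A).
Proof.
by rewrite mxtrace_trmul; do 2!apply: sumr_ge0 => ? _; rewrite sqr_ge0.
Qed.

Lemma mxtrace_trmul_eq0 p q (A : 'M[R]_(p, q)) : \tr (A^T *m A) = 0 -> A = 0.
Proof.
rewrite mxtrace_trmul => A0; apply/matrixP => i j; rewrite mxE; apply/eqP.
rewrite -sqrf_eq0 eq_le sqr_ge0 andbT -{}A0 (bigD1 i)//= (bigD1 j)//= -addrA.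
by rewrite lerDl addr_ge0// !sumr_ge0// => *; rewrite ?sumr_ge0// => *;
  rewrite sqr_ge0.
Qed.

Lemma sqr_frob_norm p q (A : 'M[R]_(p, q)) : frob_norm A ^+ 2 = \tr (A^T *m A).
Proof.
by rewrite mxtrace_trmul sqr_sqrtr// -mxtrace_trmul mxtrace_trmul_ge0.
Qed.

Lemma frob_norm0 p q : frob_norm (0 : 'M[R]_(p, q)) = 0.
Proof.
by apply/eqP; rewrite -sqrf_eq0 sqr_frob_norm mulmx0 mxtrace0.
Qed.

Lemma trmulmx_unit p q (A : 'M[R]_(p, q)) : row_full A -> A^T *m A \in unitmx.
Proof.
move=> fA; rewrite -row_free_unit; apply: inj_row_free => v vAA.
have : A *m v^T = 0.
  apply: mxtrace_trmul_eq0.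
  by rewrite trmx_mul trmxK mulmxA -(mulmxA v) vAA mul0mx mxtrace0.
move/(congr1 (mulmx (pinvmx A))); rewrite mulmxA mulVpmx// mul1mx mulmx0.
by move/(congr1 trmx); rewrite trmxK trmx0.
Qed.

(** If [v] is in the left kernel, [|A v^T|^2 + e |v|^2 = 0] has nonnegative terms, so [v = 0]. *)
Lemma trmulmxD_unit p q (A : 'M[R]_(p, q)) (e : R) : 0 < e ->
  A^T *m A + e%:M \in unitmx.
Proof.
move=> e0; rewrite -row_free_unit; apply: inj_row_free => v vA0.
have /eqP : \tr ((A *m v^T)^T *m (A *m v^T)) + e * \tr (v^T^T *m v^T) = 0.
  rewrite trmx_mul !trmxK mulmxA -(mulmxA v) -mxtraceZ -mxtraceD scalemxAl.
  by rewrite -mul_mx_scalar -mulmxDl -mulmxDr vA0 mul0mx mxtrace0.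
rewrite paddr_eq0 ?mulr_ge0 ?(ltW e0) ?mxtrace_trmul_ge0//.
rewrite mulf_eq0 (gt_eqF e0) => /andP[_ /eqP/mxtrace_trmul_eq0].
by move/(congr1 trmx); rewrite trmxK trmx0.
Qed.

(* With [X = A B] a full rank factorization, [W] is the right inverse of [B]
   times the left inverse of [A], so [X W] is the orthogonal projection onto
   the column space of [X]. *)
Lemma orthogonal_projection p q (X : 'M[R]_(p, q)) :
  exists W : 'M[R]_(q, p),
    [/\ (X *m W)^T = X *m W, X *m W *m X = X & \tr (X *m W) = (\rank X)%:R].
Proof.
have := col_base_full X; have := row_base_free X; have := mulmx_base X.
move: (col_base X) (row_base X) => A B XE fB fA.
have uA : A^T *m A \in unitmx by exact: trmulmx_unit.
exists (pinvmx B *m (invmx (A^T *m A) *m A^T)).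
set G := invmx _ *m _.
have -> : X *m (pinvmx B *m G) = A *m G.
  by rewrite -[X in X *m _]XE mulmxA -(mulmxA A) mulmxVp// mulmx1.
have GA : G *m A = 1%:M by rewrite -mulmxA mulVmx.
split.
- by rewrite /G !trmx_mul trmx_inv !trmx_mul !trmxK mulmxA.
- by rewrite -[X in _ *m X]XE mulmxA -(mulmxA A) GA mulmx1 XE.
- by rewrite mxtrace_mulC GA mxtrace1.
Qed.

End traces.

(** * Positive semidefinite matrices and Schur complements *)

Section psd.
Variable R : realType.

Lemma psdmx_mxtrace_ge0 k l (A : 'M[R]_k) (W : 'M[R]_(k, l)) :
  psdmx A -> 0 <= \tr (W^T *m A *m W).
Proof.
move=> [_ Age0]; apply: sumr_ge0 => j _.
by have := Age0 (col j W); rewrite tr_col -row_mul colE mulmxA -row_mul -colE mxE mxE.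
Qed.

Lemma mxtrace_quad_block p q l (A : 'M[R]_p) (B : 'M[R]_(p, q)) (D : 'M[R]_q)
    (U : 'M[R]_(p, l)) (V : 'M[R]_(q, l)) :
  \tr ((col_mx U V)^T *m block_mx A B B^T D *m col_mx U V) =
  \tr (U^T *m A *m U) + 2 * \tr (U^T *m B *m V) + \tr (V^T *m D *m V).
Proof.
rewrite tr_col_mx mul_row_block mul_row_col !mulmxDl !mxtraceD.
have -> : \tr (V^T *m B^T *m U) = \tr (U^T *m B *m V).
  by rewrite -mxtrace_tr !trmx_mul !trmxK mulmxA.
by ring.
Qed.

Lemma psdmx_blockP p q (A : 'M[R]_p) (B : 'M[R]_(p, q)) (D : 'M[R]_q) :
  A^T = A -> D^T = D ->
  (forall (u : 'cV_p) (v : 'cV_q),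
    0 <= \tr (u^T *m A *m u) + 2 * \tr (u^T *m B *m v) + \tr (v^T *m D *m v)) ->
  psdmx (block_mx A B B^T D).
Proof.
move=> As Ds ge0; split=> [|w]; first by rewrite tr_block_mx As Ds trmxK.
by rewrite -trace_mx11 -(vsubmxK w) mxtrace_quad_block.
Qed.

(** The vectors [e_i + e_j] and [e_i - e_j] give [2 |A i j| <= A i i + A j j], and each diagonal
    entry is at most the trace; this covers [i = j] too. *)
Lemma psdmx_norm_le_mxtrace k (A : 'M[R]_k) i j :
  psdmx A -> `|A i j| <= \tr A.
Proof.
move=> [As Age0].
have dge0 l : 0 <= A l l.
  have := Age0 (delta_mx l 0).
  by rewrite trmx_delta -rowE -colE !mxE.
have le_tr l : A l l <= \tr A.
  by rewrite /mxtrace (bigD1 l)//= lerDl sumr_ge0.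
have Aji : A j i = A i j by rewrite -{1}As mxE.
have qf s : s ^+ 2 = 1 -> 0 <= A i i + A j j + 2 * s * A i j.
  move=> s2; have := Age0 (delta_mx i 0 + s *: delta_mx j 0).
  have -> : (delta_mx i 0 + s *: delta_mx j 0)^T
      = delta_mx 0 i + s *: delta_mx 0 j :> 'rV[R]_k.
    by rewrite linearD linearZ /= !trmx_delta.
  rewrite !(mulmxDl, mulmxDr) -!scalemxAl -!scalemxAr -!rowE -!colE !mxE Aji.
  by move: s2 => /[swap]; rewrite mulrA -expr2 => + s2; rewrite s2; lra.
have hi := le_tr i; have hj := le_tr j.
have := qf 1 (expr1n _ _).
have := qf (-1) (etrans (sqrrN 1) (expr1n _ _)).
by rewrite ler_norml; lra.
Qed.

(** Minimizing the block form over its first component leads to the test vector [(- X v, v)], where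
    it equals the form of the Schur complement. *)
Lemma psdmx_schur p q (X : 'M[R]_(p, q)) (Z : 'M[R]_q) :
  Z^T = Z -> psdmx (block_mx 1%:M X X^T Z) -> psdmx (Z - X^T *m X).
Proof.
move=> Zs Zpsd; split=> [|v].
  by rewrite linearB /= trmx_mul trmxK Zs.
have := psdmx_mxtrace_ge0 (col_mx (- (X *m v)) v) Zpsd.
rewrite -trace_mx11 mxtrace_quad_block !linearN /= mulmx1 trmx_mul.
rewrite mulmxBr mulmxBl !mulNmx !mulmxA !linearN linearB /=.
lra.
Qed.

End psd.

(** * Bounds satisfied by feasible points, and a feasible point over each [X] *)

Section relaxation.
Variables (R : realType) (m n : nat).
Implicit Types (C : set 'M[R]_(m, n)) (X : 'M[R]_(m, n)) (V : 'M[R]_(n, m)).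

(* For fixed [V] a lower bound, continuous in [X], of [phi d X]; compare the
   variational formula
   [phi d X = max_V 2 tr(X V) - |X V|_F^2 - d |V|_F^2].  The entry sum replacing
   [|V|_F^2] makes [tr(V^T D V) <= tr D * sum] elementary for psd [D]. *)
Definition dual_value V (d : R) X : R :=
  2 * \tr (X *m V) - \tr ((X *m V)^T *m (X *m V))
  - d * \sum_i \sum_j `|(V *m V^T) i j|.

Lemma feasible_mxtrace_ge C eps Y Z X V : 0 < eps -> feasible C eps Y Z X ->
  dual_value V (eps + (\tr Z - \tr (X^T *m X))) X <= \tr Y.
Proof.
move=> e0 [Ys Zs YX ZX CX]; set D := Z - X^T *m X.
have Dpsd : psdmx D by exact: psdmx_schur.
have trD : \tr Z - \tr (X^T *m X) = \tr D by rewrite linearB.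
pose c : R := \sum_i \sum_j `|(V *m V^T) i j|.
have VVc : \tr (V *m V^T) <= c.
  apply: ler_sum => i _; rewrite (bigD1 i)//=.
  by rewrite (le_trans (ler_norm _))// lerDl sumr_ge0.
(* The left side is [tr (V V^T D)], a sum of products of entries, and the entries of [D] are bounded
   by [tr D]. *)
have DVc : \tr (V^T *m D *m V) <= \tr D * c.
  rewrite mxtrace_mulC mulmxA mulr_sumr; apply: ler_sum => i _.
  rewrite mxE mulr_sumr; apply: ler_sum => j _.
  rewrite mulrC (le_trans (ler_norm _))// normrM ler_wpM2r//.
  exact: psdmx_norm_le_mxtrace.
have := psdmx_mxtrace_ge0 (col_mx 1%:M (- V)) YX.
rewrite mxtrace_quad_block trmx1 !mul1mx !mulmx1 mulmxN linearN /= !linearN /=.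
rewrite !mulNmx linearN /= opprK.
have -> : Z + eps%:M = D + X^T *m X + eps%:M by rewrite subrK.
clearbody D.
rewrite !mulmxDr !mulmxDl !mxtraceD mul_mx_scalar -scalemxAl mxtraceZ.
rewrite /dual_value trD -/c (mxtrace_mulC V^T V) trmx_mul !mulmxA.
have := ler_wpM2l (ltW e0) VVc.
lra.
Qed.

Lemma feasible_mxtraceZ_ge C eps Y Z X : feasible C eps Y Z X ->
  frob_norm X ^+ 2 <= \tr Z.
Proof.
case=> _ Zs _ /(psdmx_schur Zs) Dpsd _.
have := psdmx_mxtrace_ge0 1%:M Dpsd.
by rewrite trmx1 mul1mx mulmx1 linearB /= subr_ge0 sqr_frob_norm.
Qed.

(** This is the dual bound at [V = 0]. *)
Lemma feasible_mxtraceY_ge0 C eps Y Z X : 0 < eps -> feasible C eps Y Z X ->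
  0 <= \tr Y.
Proof.
move=> e0 /(feasible_mxtrace_ge 0 e0); rewrite /dual_value !mulmx0 mxtrace0.
rewrite big1 ?mulr0 ?subr0 ?mulr0// => i _.
by rewrite big1// => j _; rewrite mul0mx mxE normr0.
Qed.

(** Both block forms become squares: the first is [w^T A w] with [w = A^-1 X^T u + v], the second is
    [|u + X v|^2]. *)
Lemma feasible_phi C eps X : 0 < eps -> C X ->
  feasible C eps (X *m invmx (X^T *m X + eps%:M) *m X^T) (X^T *m X) X.
Proof.
move=> e0 CX; set A := X^T *m X + eps%:M.
have uA : A \in unitmx by exact: trmulmxD_unit.
have Gs : (X^T *m X)^T = X^T *m X by rewrite trmx_mul trmxK.
have As : A^T = A by rewrite linearD /= Gs tr_scalar_mx.
have Ps : (X *m invmx A *m X^T)^T = X *m invmx A *m X^T.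
  by rewrite !trmx_mul trmxK trmx_inv As mulmxA.
split=> //; apply: psdmx_blockP => //; rewrite ?tr_scalar_mx//.
- rewrite -/A; have Age0 (w : 'cV_n) : 0 <= \tr (w^T *m A *m w).
    rewrite /A mulmxDr mulmxDl mxtraceD mul_mx_scalar -scalemxAl mxtraceZ.
    rewrite addr_ge0 ?mulr_ge0 ?(ltW e0) ?mxtrace_trmul_ge0//.
    by rewrite mulmxA -mulmxA -trmx_mul mxtrace_trmul_ge0.
  clearbody A => u v; pose w := invmx A *m (X^T *m u) + v.
  have -> : \tr (u^T *m (X *m invmx A *m X^T) *m u) + 2 * \tr (u^T *m X *m v)
      + \tr (v^T *m A *m v) = \tr (w^T *m A *m w).
    have -> : w^T = u^T *m X *m invmx A + v^T.
      by rewrite linearD /= !trmx_mul trmxK trmx_inv As.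
    rewrite /w !(mulmxDl, mulmxDr).
    rewrite !mxtraceD !mulmxA (mulmxKV uA) (mulmxK uA).
    have -> : \tr (v^T *m X^T *m u) = \tr (u^T *m X *m v).
      by rewrite -mxtrace_tr !trmx_mul !trmxK mulmxA.
    ring.
  exact: Age0.
- move=> u v.
  have -> : \tr (u^T *m 1%:M *m u) + 2 * \tr (u^T *m X *m v)
      + \tr (v^T *m (X^T *m X) *m v) = \tr ((u + X *m v)^T *m (u + X *m v)).
    have -> : (u + X *m v)^T = u^T + v^T *m X^T by rewrite linearD /= trmx_mul.
    rewrite mulmx1 !(mulmxDl, mulmxDr) !mxtraceD !mulmxA.
    have -> : \tr (v^T *m X^T *m u) = \tr (u^T *m X *m v).
      by rewrite -mxtrace_tr !trmx_mul !trmxK mulmxA.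
    ring.
  exact: mxtrace_trmul_ge0.
Qed.

(* With [Q] the orthogonal projection onto the column space of [X] and [P] the
   matrix whose trace is [phi eps X], expand [0 <= |Q - P|_F^2], using
   [tr (Q P) = tr P] and [tr (P P) <= tr P]. *)
Lemma phi_le_rank eps X : 0 < eps -> phi eps X <= (\rank X)%:R.
Proof.
move=> e0; rewrite /phi; set A := X^T *m X + eps%:M.
have uA : A \in unitmx by exact: trmulmxD_unit.
have As : A^T = A by rewrite linearD /= trmx_mul trmxK tr_scalar_mx.
set P := X *m invmx A *m X^T.
have Ps : P^T = P by rewrite !trmx_mul trmxK trmx_inv As mulmxA.
have [W [Qs QX trQ]] := orthogonal_projection X.
set Q := X *m W in Qs QX trQ.
have QQ : Q *m Q = Q by rewrite {2}/Q mulmxA QX.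
have QP : Q *m P = P by rewrite /P !mulmxA QX.
have PP : \tr (P *m P) <= \tr P.
  have -> : P *m P = P - eps *: ((X *m invmx A) *m (X *m invmx A)^T).
    have XX : X^T *m X = A - eps%:M by rewrite addrK.
    rewrite {1 2}/P !mulmxA -(mulmxA _ X^T) XX mulmxBr mulmxKV//.
    rewrite mul_mx_scalar !mulmxBl -!scalemxAl.
    by rewrite [in RHS]trmx_mul trmx_inv As !mulmxA.
  rewrite linearB /= mxtraceZ gerBl mulr_ge0 ?(ltW e0)//.
  by rewrite mxtrace_mulC mxtrace_trmul_ge0.
have := mxtrace_trmul_ge0 (Q - P).
have -> : (Q - P)^T = Q - P by rewrite linearB /= Qs Ps.
clearbody P Q; rewrite mulmxBl !mulmxBr QQ QP !linearB /= opprK.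
by rewrite (mxtrace_mulC P) QP trQ; lra.
Qed.

End relaxation.

(** * Compactness and continuity in matrix space *)

Section topology.
Variable R : realType.

Lemma norm_coord_le_mx p q (X : 'M[R]_(p, q)) i j : `|X i j| <= `|X|.
Proof.
by rewrite [leRHS]/Num.norm/= mx_normrE; apply/bigmax_geP; right; exists (i, j).
Qed.

Lemma continuous_vec_mx p q : continuous (@vec_mx R p q).
Proof.
move=> v A [P nP PA].
apply: (filterS (P := [set w | forall i j, P i j (vec_mx w i j)])) => [w Pw|].
  exact: PA.
have vF : Filter (nbhs v) by exact: nbhs_filter.
apply: (@filter_forall _ _ (fun i w => forall j, P i j (vec_mx w i j)) _ vF) => i.
apply: (@filter_forall _ _ (fun j w => P i j (vec_mx w i j)) _ vF) => j.
rewrite /prop_near1 /= (_ : (fun w => _) =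
    (fun w : 'rV_(p * q) => w 0 (mxvec_index i j)) @^-1` P i j).
  by apply: coord_continuous; have := nP i j; rewrite mxE.
by apply/funext => w; rewrite /= mxE.
Qed.

(** [A] is a closed subset of the image under [vec_mx] of a compact box of row vectors. *)
Lemma bounded_closed_compact_mx p q (A : set 'M[R]_(p, q)) :
  bounded_set A -> closed A -> compact A.
Proof.
(* Boundedness gives a norm bound by every number strictly above [M], hence the [+ 1]. *)
move=> [M [_ AM]] Acl; pose N := M + 1.
pose B := [set v : 'rV[R]_(p * q) | forall k, `[- N, N]%classic (v ord0 k)].
have cB : compact B.
  apply: (@rV_compact _ _ (fun=> `[- N, N]%classic)) => _.
  exact: segment_compact.
have cvB : compact (vec_mx @` B).
  apply: continuous_compact => //.
  exact/continuous_subspaceT/continuous_vec_mx.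
apply: (subclosed_compact Acl cvB) => X AX; exists (mxvec X); last exact: mxvecK.
move=> k; case/mxvec_indexP: k => a b; rewrite /= mxvecE in_itv /= -ler_norml.
by apply: le_trans (norm_coord_le_mx _ _ _) _; apply: AM AX; rewrite ltrDl.
Qed.

Lemma continuous_mulmxr p q r (V : 'M[R]_(q, r)) i j :
  continuous (fun X : 'M[R]_(p, q) => (X *m V) i j).
Proof.
have -> : (fun X : 'M[R]_(p, q) => (X *m V) i j)
    = fun X => \sum_k X i k * V k j.
  by apply/funext => X; rewrite mxE.
apply: continuous_big => [|k _ X]; first exact: add_continuous.
exact: (cvgM (@coord_continuous _ _ _ i k X) (cvg_cst _)).
Qed.

Lemma continuous_sum_sqr (T : topologicalType) p q (f : T -> 'M[R]_(p, q)) :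
  (forall i j, continuous (fun x => f x i j)) ->
  continuous (fun x => \tr ((f x)^T *m f x)).
Proof.
move=> fc; under eq_fun do rewrite mxtrace_trmul.
apply: continuous_big => [|i _]; first exact: add_continuous.
apply: continuous_big => [|j _ x]; first exact: add_continuous.
by apply: cvgM; exact: fc.
Qed.

Lemma continuous_frob_normB p q (W : 'M[R]_(p, q)) :
  continuous (fun X : 'M[R]_(p, q) => frob_norm (X - W)).
Proof.
have fE Y : frob_norm (Y - W) = Num.sqrt (\tr ((Y - W)^T *m (Y - W))).
  by rewrite /frob_norm mxtrace_trmul.
move=> X; rewrite (funext fE).
apply: continuous_comp; last exact: sqrt_continuous.
apply: continuous_sum_sqr => i j.
have -> : (fun Y => (Y - W) i j) = fun Y : 'M[R]_(p, q) => Y i j - W i j.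
  by apply/funext => Y; rewrite !mxE.
by move=> Y; exact: (cvgB (@coord_continuous _ _ _ i j Y) (cvg_cst _)).
Qed.

Variables (m n : nat).
Implicit Types (V : 'M[R]_(n, m)).

Lemma continuous_dual_value V d : continuous (@dual_value R m n V d).
Proof.
have cT : continuous (fun X : 'M[R]_(m, n) => \tr (X *m V)).
  apply: continuous_big => [|i _]; first exact: add_continuous.
  exact: continuous_mulmxr.
have cS : continuous (fun X : 'M[R]_(m, n) => \tr ((X *m V)^T *m (X *m V))).
  by apply: continuous_sum_sqr => i j; exact: continuous_mulmxr.
by move=> X; exact: (cvgB (cvgB (cvgM (cvg_cst _) (cT X)) (cS X)) (cvg_cst _)).
Qed.

(** By compactness it suffices to treat a joint neighbourhood of each [(X, 0)]; there a single [W],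
    taken from the projection at [X], serves all nearby matrices. *)
Lemma near_dual_value_gt (K : set 'M[R]_(m, n)) (c : R) : compact K ->
  (forall X, K X -> c < (\rank X)%:R) ->
  \forall d \near (0 : R), forall X, K X -> exists V, c < dual_value V d X.
Proof.
move=> /compact_near_coveringP cK Kc.
apply: (cK _ (nbhs (0 : R)) (fun d X => exists V, c < dual_value V d X) _).
move=> X /Kc cX.
have [W [Ws WX trW]] := orthogonal_projection X.
have gX : dual_value W 0 X = (\rank X)%:R.
  by rewrite /dual_value mul0r subr0 Ws mulmxA WX trW; lra.
pose b : R := \sum_i \sum_j `|(W *m W^T) i j|.
(* Half of the gap: one half absorbs the variation in [X], the other the penalty [d * b]. *)
pose e := ((\rank X)%:R - c) / 2.
have ce : c + e < dual_value W 0 X by rewrite gX /e; lra.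
have de : \forall d \near (0 : R), d * b < e.
  have cb : d * b @[d --> (0 : R)] --> 0 * b.
    exact: (cvgM (@cvg_id _ (nbhs (0 : R))) (cvg_cst b)).
  have be : 0 * b < e by rewrite mul0r /e; lra.
  exact: (cvgr_lt _ cb _ be).
have Xe := cvgr_gt _ (@continuous_dual_value W 0 X) _ ce.
exists ([set X' | c + e < dual_value W 0 X'], [set d | d * b < e]).
  by split; [exact: Xe|exact: de].
move=> -[X' d] /= [X'e db]; exists W.
by move: X'e; rewrite /dual_value -/b; lra.
Qed.

End topology.

Lemma dual_value_le (R : realType) m n (V : 'M[R]_(n, m)) d d' X : d <= d' ->
  dual_value V d' X <= dual_value V d X.
Proof.
move=> dd'; rewrite /dual_value lerD2l lerN2 ler_wpM2r//.
by do 2!apply: sumr_ge0 => ? _.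
Qed.

(** * Limits along the filter [ratio_to0] *)

Section limits.
Variable R : realType.

Lemma near_ratio_to0_gt0 : \forall p \near ratio_to0 R, 0 < p.1 /\ 0 < p.2.
Proof. by exists 1 => // x y /andP[? _] /andP[? _]. Qed.

Lemma cvg_ratio_to0_fst : p.1 @[p --> ratio_to0 R] --> (0 : R).
Proof.
apply/cvgrPdist_le => e e0; exists e => // x y /andP[x0 xe] _ _ /=.
by rewrite sub0r normrN gtr0_norm// ltW.
Qed.

Lemma cvg_ratio_to0_snd : p.2 @[p --> ratio_to0 R] --> (0 : R).
Proof.
apply/cvgrPdist_le => e e0; exists e => // x y _ /andP[y0 ye] _ /=.
by rewrite sub0r normrN gtr0_norm// ltW.
Qed.

Lemma near_ratio_to0 (r : R) (P : R -> Prop) : (\forall d \near (0 : R), P d) ->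
  \forall p \near ratio_to0 R, P (p.1 + p.2 * r).
Proof.
have : p.1 + p.2 * r @[p --> ratio_to0 R] --> 0 + 0 * r.
  apply: cvgD; first exact: cvg_ratio_to0_fst.
  by apply: cvgM; [exact: cvg_ratio_to0_snd|exact: cvg_cst].
by rewrite mul0r addr0; apply.
Qed.

Lemma frob_dist_ge0 m n (X : 'M[R]_(m, n)) S : (0 <= frob_dist X S)%E.
Proof. by apply/ereal_infP => _ [W _ <-]; rewrite lee_fin sqrtr_ge0. Qed.

(** The bound with [e = 1] makes [f] eventually finite, which reduces the claim to a real limit. *)
Lemma cvg_ge0_ereal0 (T : Type) (F : set_system T) (FF : Filter F)
    (f : T -> \bar R) :
  (forall x, 0 <= f x)%E ->
  (forall e : R, 0 < e -> \forall x \near F, (f x <= e%:E)%E) ->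
  f x @[x --> F] --> 0%E.
Proof.
move=> f0 fe; have ffin x e : (f x <= e%:E)%E -> f x \is a fin_num.
  by move=> fxe; rewrite ge0_fin_numE// (le_lt_trans fxe) ?ltry.
apply/fine_cvgP; split; first by apply: filterS (fe 1 ltr01) => x /ffin.
apply/cvgrPdist_le => e e0; apply: filterS (fe e e0) => x fxe /=.
rewrite sub0r normrN ger0_norm ?fine_ge0// -lee_fin fineK//.
exact: ffin fxe.
Qed.

End limits.

Theorem theorem3p1 (R : realType) (m n : nat) (C : set 'M[R]_(m, n))
  (Cbounded : bounded_set C) (Cclosed : closed C)
  (Xstar : 'M[R]_(m, n)) (CXstar : C Xstar)
  (Xstar_min : forall X : 'M[R]_(m, n), C X ->
     (\rank Xstar <= \rank X)%N /\ frob_norm Xstar <= frob_norm X)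
  (Y : R -> R -> 'M[R]_m) (Z : R -> R -> 'M[R]_n)
  (X : R -> R -> 'M[R]_(m, n))
  (YZXopt : forall eps gam : R, 0 < eps -> 0 < gam ->
     optimal C eps gam (Y eps gam) (Z eps gam) (X eps gam)) :
  [/\ forall eps gam : R, 0 < eps -> 0 < gam ->
        \tr (Y eps gam) <= phi eps Xstar <= (\rank Xstar)%:R,
      \tr (Y p.1 p.2) @[p --> ratio_to0 R] --> ((\rank Xstar)%:R : R),
      \tr (Z p.1 p.2) @[p --> ratio_to0 R] --> frob_norm Xstar ^+ 2 &
      frob_dist (X p.1 p.2) (min_rank_solutions C) @[p --> ratio_to0 R]
        --> 0%E].
Proof.
set r : R := (\rank Xstar)%:R; set N : R := frob_norm Xstar ^+ 2.
have CX eps gam : 0 < eps -> 0 < gam -> C (X eps gam).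
  by move=> e0 g0; have [[]] := YZXopt _ _ e0 g0.
have NX W : C W -> N <= frob_norm W ^+ 2.
  by move=> /Xstar_min[_ NW]; rewrite lerXn2r ?nnegrE ?sqrtr_ge0.
have NZ eps gam : 0 < eps -> 0 < gam -> N <= \tr (Z eps gam).
  move=> e0 g0; have [F _] := YZXopt _ _ e0 g0.
  exact: le_trans (NX _ (CX _ _ e0 g0)) (feasible_mxtraceZ_ge F).
(* Optimality against the feasible point over [Xstar], multiplied by [gam]. *)
have obj eps gam : 0 < eps -> 0 < gam ->
    gam * \tr (Y eps gam) + \tr (Z eps gam) <= gam * phi eps Xstar + N.
  move=> e0 g0; have [_ opt] := YZXopt _ _ e0 g0.
  have := opt _ _ _ (feasible_phi e0 CXstar).
  rewrite /objective -(ler_pM2l g0) !mulrDr !mulrA divff ?gt_eqF// !mul1r.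
  by rewrite /N sqr_frob_norm.
have Yphi eps gam : 0 < eps -> 0 < gam -> \tr (Y eps gam) <= phi eps Xstar.
  move=> e0 g0; rewrite -(ler_pM2l g0).
  by have := NZ _ _ e0 g0; have := obj _ _ e0 g0; lra.
have phir eps : 0 < eps -> phi eps Xstar <= r by exact: phi_le_rank.
have Yr eps gam : 0 < eps -> 0 < gam -> \tr (Y eps gam) <= r.
  by move=> e0 g0; apply: le_trans (Yphi _ _ e0 g0) (phir _ e0).
(* In [obj], drop [gam * tr Y >= 0] and bound [phi] by [r]. *)
have ZN eps gam : 0 < eps -> 0 < gam -> \tr (Z eps gam) <= N + gam * r.
  move=> e0 g0; have [F _] := YZXopt _ _ e0 g0.
  have := ler_wpM2l (ltW g0) (phir _ e0).
  have := mulr_ge0 (ltW g0) (feasible_mxtraceY_ge0 e0 F).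
  by have := obj _ _ e0 g0; lra.
(* As [|X|^2 >= N], the slack [tr Z - |X|^2] is at most [gam * r]. *)
have dualY eps gam V : 0 < eps -> 0 < gam ->
    dual_value V (eps + gam * r) (X eps gam) <= \tr (Y eps gam).
  move=> e0 g0; have [F _] := YZXopt _ _ e0 g0.
  apply: le_trans (feasible_mxtrace_ge V e0 F); apply: dual_value_le.
  rewrite lerD2l -sqr_frob_norm.
  by have := NX _ (CX _ _ e0 g0); have := ZN _ _ e0 g0; lra.
have cC : compact C by exact: bounded_closed_compact_mx.
split.
- by move=> eps gam e0 g0; rewrite Yphi// phir.
- apply/cvgrPdist_le => e e0.
  have Ce W : C W -> r - e < (\rank W)%:R.
    move=> /Xstar_min[rW _]; have : r <= (\rank W)%:R by rewrite ler_nat.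
    by lra.
  have := near_ratio_to0 r (near_dual_value_gt cC Ce).
  apply: (@filterS2 _ (ratio_to0 R) _ _ _ _ _ (near_ratio_to0_gt0 R)).
  move=> -[eps gam] /= [eps0 gam0] CV.
  have [V rV] := CV _ (CX _ _ eps0 gam0).
  have := lt_le_trans rV (dualY _ _ V eps0 gam0).
  by have := Yr _ _ eps0 gam0; rewrite ler_norml; lra.
- have sq : \forall p \near ratio_to0 R, N <= \tr (Z p.1 p.2) <= N + p.2 * r.
    apply: (@filterS _ (ratio_to0 R) _ _ _ _ (near_ratio_to0_gt0 R)).
    move=> -[eps gam] /= [eps0 gam0].
    by rewrite NZ// ZN.
  have cub : N + p.2 * r @[p --> ratio_to0 R] --> N + 0 * r.
    apply: cvgD; first exact: cvg_cst.
    by apply: cvgM; [exact: cvg_ratio_to0_snd|exact: cvg_cst].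
  rewrite mul0r addr0 in cub.
  exact: (squeeze_cvgr sq (cvg_cst N) cub).
- apply: cvg_ge0_ereal0 => [p|e e0]; first exact: frob_dist_ge0.
  (* The open [e]-neighbourhood of the minimizers. On the compact set [C] minus [U] the rank exceeds
     [r], so an optimal [X] there would force [tr Y > r], against [Yr]. *)
  pose U := \bigcup_(W in min_rank_solutions C) [set V | frob_norm (V - W) < e].
  have oU : open U.
    apply: bigcup_open => W _.
    have cW := @continuous_frob_normB R m n W.
    exact: (open_comp (fun V _ => cW V) (@open_lt _ e)).
  have cK : compact (C `\` U).
    apply: (subclosed_compact _ cC) => [|V []//].
    by apply: closedI => //; exact: open_closedC.
  have Kr W : (C `\` U) W -> r < (\rank W)%:R.
    move=> [CW nUW]; have [rW _] := Xstar_min _ CW.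
    rewrite ltr_nat ltn_neqAle rW andbT; apply/eqP => rWE; apply: nUW.
    exists W; last by rewrite /= subrr frob_norm0.
    by split=> // V /Xstar_min[]; rewrite rWE.
  have := near_ratio_to0 r (near_dual_value_gt cK Kr).
  apply: (@filterS2 _ (ratio_to0 R) _ _ _ _ _ (near_ratio_to0_gt0 R)).
  move=> -[eps gam] /= [eps0 gam0] KV.
  have [[W MW XW]|nU] := pselect (U (X eps gam)).
    by apply: ge_ereal_inf; exists (frob_norm (X eps gam - W))%:E;
      [exists W|rewrite lee_fin ltW].
  have [V rV] := KV _ (conj (CX _ _ eps0 gam0) nU).
  have := lt_le_trans rV (dualY _ _ V eps0 gam0).
  by rewrite ltNge Yr.
Qed.
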